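(* There exists a binary language $L_{\mathrm{univ}}\subseteq\{0,1\}^*$ such that every separable real Banach space admits a linear isometric embedding into $X_{L_{\mathrm{univ}}}$.
   Context: $\{0,1\}^*$ is the free monoid of finite binary words. For $L\subseteq\{0,1\}^*$ and a word $w$, $w^{-1}L=\{v\in\{0,1\}^*:wv\in L\}$, $\mathbf 1_B$ is the characteristic function of $B$, and $X_L=\overline{\operatorname{span}}\{\mathbf 1_{w^{-1}L}:w\in\{0,1\}^*\}\subset\ell_\infty(\{0,1\}^* )$ (real linear span), where $\ell_\infty(\{0,1\}^* )$ is the space of bounded real functions on $\{0,1\}^*$ with the supremum norm and the closure is in that norm. *)

(* Defs.v *)
From HB Require Import structures.
From mathcomp Require Import all_boot all_order all_algebra.
From mathcomp Require Import all_classical all_reals all_analysis.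

Set Implicit Arguments.
Unset Strict Implicit.
Unset Printing Implicit Defensive.

Import Order.TTheory GRing.Theory Num.Theory.
Import numFieldNormedType.Exports.

Local Open Scope classical_set_scope.
Local Open Scope ring_scope.

Definition bounded_pred (T : Type) (R : realType) : {pred T -> R} :=
  mem bounded_fun.
Arguments bounded_pred : clear implicits.

Record ell_infty (T : Type) (R : realType) : Type := EllInfty {
  ell_fun :> T -> R;
  ell_funP : ell_fun \in bounded_pred T R }.

Section EllInftyTheory.
Context {T : Type} {R : realType}.
Local Notation E := (ell_infty T R).

Lemma bounded_predP (f : T -> R) :
  reflect (exists M, forall t, `|f t| <= M) (f \in bounded_pred T R).
Proof.
apply: (iffP idP) => [/set_mem/pinfty_ex_gt0[M _ fM]|[M fM]].
  by exists M => t; exact: fM.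
apply/mem_set; exists M; split => [|x Mx t _]; first exact: num_real.
exact: le_trans (fM t) (ltW Mx).
Qed.

Lemma bounded_submod_closed : submod_closed (bounded_pred T R).
Proof.
split; first by apply/bounded_predP; exists 0 => t; rewrite normr0.
move=> a f g /bounded_predP[M fM] /bounded_predP[N gN].
apply/bounded_predP; exists (`|a| * M + N) => t.
by rewrite (le_trans (ler_normD _ _))// lerD// normrM ler_wpM2l.
Qed.

HB.instance Definition _ :=
  GRing.isSubmodClosed.Build R (T -> R) (bounded_pred T R)
    bounded_submod_closed.

HB.instance Definition _ := [isSub of E for @ell_fun T R].
HB.instance Definition _ := [Choice of E by <:].
HB.instance Definition _ := [SubChoice_isSubLmodule of E by <:].

(* If T is empty, the supremum is sup set0 = 0. *)
Definition sup_norm (f : E) : R := sup (range (fun t => `|f t|)).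

Lemma sup_norm_ge (f : E) t : `|f t| <= sup_norm f.
Proof.
apply: ub_le_sup; last by exists t.
by have /bounded_predP[M fM] := ell_funP f; exists M => _ [u _ <-].
Qed.

Lemma sup_norm_le (f : E) M :
  0 <= M -> (forall t, `|f t| <= M) -> sup_norm f <= M.
Proof.
move=> M0 fM; rewrite /sup_norm.
have [->|/set0P f0] := eqVneq (range (fun t => `|f t|)) set0.
  by rewrite sup0.
by apply: ge_sup => // _ [t _ <-].
Qed.

Lemma sup_norm_ge0 (f : E) : 0 <= sup_norm f.
Proof.
rewrite /sup_norm.
have [->|/set0P[_ [t _ _]]] := eqVneq (range (fun t => `|f t|)) set0.
  by rewrite sup0.
exact: le_trans (sup_norm_ge f t).
Qed.

Lemma ler_sup_normD (f g : E) : sup_norm (f + g) <= sup_norm f + sup_norm g.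
Proof.
apply: sup_norm_le => [|t]; first by rewrite addr_ge0 ?sup_norm_ge0.
by rewrite (le_trans (ler_normD _ _))// lerD ?sup_norm_ge.
Qed.

Lemma sup_normZ (a : R) (f : E) : sup_norm (a *: f) = `|a| * sup_norm f.
Proof.
have leZ (b : R) (g : E) : sup_norm (b *: g) <= `|b| * sup_norm g.
  apply: sup_norm_le => [|t]; first by rewrite mulr_ge0 ?sup_norm_ge0.
  by rewrite normrM ler_wpM2l ?sup_norm_ge.
have [->|a0] := eqVneq a 0.
  apply/eqP; rewrite normr0 mul0r eq_le sup_norm_ge0 andbT.
  by rewrite (le_trans (leZ _ _))// normr0 mul0r.
apply/eqP; rewrite eq_le leZ/= -ler_pdivlMl ?normr_gt0// -normfV.
by rewrite -[in leLHS](scalerK a0 f) leZ.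
Qed.

Lemma sup_norm0_eq0 (f : E) : sup_norm f = 0 -> f = 0.
Proof.
move=> f0; apply/val_inj/funext => t; apply/eqP.
by rewrite -normr_le0 -f0 sup_norm_ge.
Qed.

HB.instance Definition _ := Lmodule_isNormed.Build R E
  ler_sup_normD sup_normZ sup_norm0_eq0.

Lemma bounded_indic (A : set T) : \1_A \in bounded_pred T R.
Proof.
apply/bounded_predP; exists 1 => t.
by rewrite indicE; case: (t \in A); rewrite ?normr1 ?normr0.
Qed.

Definition ell_indic (A : set T) : E := EllInfty (bounded_indic A).

End EllInftyTheory.

Definition lin_span (R : pzRingType) (V : lmodType R) (A : set V) : set V :=
  [set v | exists (n : nat) (c : 'I_n -> R) (a : 'I_n -> V),
     (forall i, A (a i)) /\ v = \sum_(i < n) c i *: a i].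

Definition separable_space (T : topologicalType) : Prop :=
  exists D : set T, countable D /\ dense D.

Definition word : Type := seq bool.

Definition left_quotient (w : word) (L : set word) : set word :=
  [set v | L (w ++ v)].

(* The closed real linear span X_L, as a subset of the normed space ell_infty;
   the closure is for the topology of the supremum norm declared above. *)
Definition language_space (R : realType) (L : set word) :
    set (ell_infty word R) :=
  closure (lin_span [set ell_indic (left_quotient w L) | w in [set: word]]).

Arguments language_space : clear implicits.

(* X need not be a subspace: F only provides the ambient norm. *)
Definition linear_isometric_embeds (R : realType) (E F : normedModType R)
    (X : set F) : Prop :=
  exists f : {linear E -> F}, (forall x, `|f x| = `|x|) /\ (forall x, X (f x)).

(* Main.v *)
From HB Require Import structures.
Require Import Defs.
From mathcomp Require Import all_boot all_order all_algebra.
From mathcomp Require Import all_classical all_reals all_analysis.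
From mathcomp Require Import lra.

(** The universal language is L = { c(u) v : u is a prefix of v }, where c is a
    self-delimiting code. Since c(u) can be read off the front of a word, the
    quotient of L by c(u) is exactly the cone of all words extending u
    ([left_quotient_prefix_language]), so X_L contains the closed span of the
    indicators of the cones of the binary tree. That span contains every
    function on words whose value at v depends only on a prefix of v of bounded
    length: telescoping along the prefixes of v writes such a function as a
    finite combination of cones ([truncation_in_span]). By density, X_L
    contains every bounded F that is uniformly approximated by its truncations
    v |-> F (take N v).

    This is C(K) for K the compactified binary tree (finite words together with
    infinite branches), which contains the Cantor set, and the theorem becomes a
    form of the Banach-Mazur theorem. Given a separable E, a tree of functionals
    psi_v in the unit ball of the dual is built so that for every x the map
    v |-> psi_v(x) is uniformly approximated by its truncations, and so that
    the psi_v come arbitrarily close to every functional of the ball, tested at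
    x. Then x |-> (v |-> psi_v(x)) is linear, of norm at most 1, lands in X_L,
    and is isometric because x has a norming functional.

    The tree replaces the compactness of the dual ball by total boundedness.
    Countably many two-valued tests on functionals suffice to determine every
    phi(x) up to any given error, with finitely many tests for each x and each
    error ([dual_ball_tests]); the k-th letter of v prescribes the answer to the
    k-th test whenever some functional compatible with the earlier answers
    permits it ([binary_tree_of_tests]). Working with finite words rather than
    infinite branches makes it unnecessary to pass to a limit functional.

    Norming functionals come from the Hahn-Banach theorem in its sublinear
    form: by Zorn's lemma every sublinear functional dominates a minimal one,
    and a minimal one is linear ([hahn_banach_sublinear]). *)

Set Implicit Arguments.
Unset Strict Implicit.
Unset Printing Implicit Defensive.

Import Order.TTheory GRing.Theory Num.Theory.
Import numFieldNormedType.Exports.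

Local Open Scope classical_set_scope.
Local Open Scope ring_scope.

(** * The Hahn-Banach theorem and norming functionals *)

(** Homogeneity is only required as an inequality for t > 0, which is what
    infima inherit directly; equality follows by applying it to 1/t. *)
Definition sublinear (R : realType) (E : lmodType R) (p : E -> R) : Prop :=
  (forall x y, p (x + y) <= p x + p y) /\
  (forall t x, 0 < t -> p (t *: x) <= t * p x).

Lemma sublinear0 (R : realType) (E : lmodType R) (p : E -> R) :
  sublinear p -> p 0 = 0.
Proof.
move=> [pD pZ]; have := pD 0 0; have := pZ 2^-1 0.
by rewrite scaler0 addr0 invr_gt0 ltr0n => /(_ isT); lra.
Qed.

Lemma sublinearZ (R : realType) (E : lmodType R) (p : E -> R) t x :
  sublinear p -> 0 < t -> p (t *: x) = t * p x.
Proof.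
move=> [_ pZ] t0; apply/eqP; rewrite eq_le pZ//=.
have := pZ t^-1 (t *: x); rewrite invr_gt0 => /(_ t0).
by rewrite scalerA mulVf ?gt_eqF// scale1r ler_pdivlMl.
Qed.

Lemma sublinear_geN (R : realType) (E : lmodType R) (p : E -> R) x :
  sublinear p -> - p (- x) <= p x.
Proof.
by move=> sp; have := sp.1 x (- x); rewrite subrr (sublinear0 sp); lra.
Qed.

(** Subadditivity of an infimum needs one member of the family that controls a
    sum of two arbitrary members, and homogeneity a member for each rescaling.
    Both the chains in Zorn's lemma and the shifts of a functional along a ray
    are families of this kind. *)
Lemma sublinear_inf (R : realType) (E : lmodType R) (P : set (E -> R)) :
  P !=set0 ->
  (forall x, exists m, forall p, P p -> m <= p x) ->
  (forall p q, P p -> P q ->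
     exists2 r, P r & forall x y, r (x + y) <= p x + q y) ->
  (forall p t, P p -> 0 < t ->
     exists2 r, P r & forall x, r (t *: x) <= t * p x) ->
  exists i, [/\ sublinear i, (forall p x, P p -> i x <= p x) &
                forall m x, (forall p, P p -> m <= p x) -> m <= i x].
Proof.
move=> [p0 Pp0] Plb PD PZ.
pose i x := inf [set p x | p in P].
have i_le p x : P p -> i x <= p x.
  move=> Pp; apply: ge_inf; last by exists p.
  by have [m mP] := Plb x; exists m => _ [q Pq <-]; exact: mP.
have le_i m x : (forall p, P p -> m <= p x) -> m <= i x.
  move=> mP; apply: lb_le_inf => [|_ [q Pq <-]]; last exact: mP.
  by exists (p0 x), p0.
exists i; split=> //; split=> [x y|t x t0].
  rewrite -lerBlDr; apply/le_i => p Pp.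
  suff : i (x + y) - p x <= i y by lra.
  apply/le_i => q Pq; have [r Pr rpq] := PD _ _ Pp Pq.
  by have := i_le _ (x + y) Pr; have := rpq x y; lra.
rewrite mulrC -ler_pdivrMr//; apply/le_i => p Pp.
have [r Pr rp] := PZ _ _ Pp t0.
by rewrite ler_pdivrMr// mulrC (le_trans _ (rp x)) ?i_le.
Qed.

(** Here q y is the infimum over t > 0 of p (y + t x) - t p x, the slope of p at
    infinity along x. The last inequality is the instance t = 1; it has two
    uses: for minimal p it forces additivity, and at y = - x it
    gives q (- x) <= - p x, so that a linear functional below q is at least
    p x at x. *)
Lemma sublinear_directional (R : realType) (E : lmodType R) (p : E -> R)
    (x : E) :
  sublinear p ->
  exists q, [/\ sublinear q, (forall y, q y <= p y) &
                forall y, q y <= p (y + x) - p x].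
Proof.
move=> sp; have [pD pZ] := sp.
pose shift t := fun y => p (y + t *: x) - t * p x.
have shift1 y : shift 1 y = p (y + x) - p x by rewrite /shift scale1r mul1r.
have [|y|_ _ [s s0 <-] [t t0 <-]|_ s [t t0 <-] s0|] :=
    @sublinear_inf _ _ [set shift t | t in [set t | 0 < t]].
- by exists (shift 1), 1 => //=.
- exists (- p (- y)) => _ [t t0 <-]; rewrite /shift -(sublinearZ _ sp)//.
  by have := pD (y + t *: x) (- y); rewrite addrC addKr; lra.
- exists (shift (s + t)) => [|y z].
    by exists (s + t) => //=; rewrite addr_gt0.
  by have := pD (y + s *: x) (z + t *: x); rewrite /shift scalerDl addrACA; lra.
- exists (shift (s * t)) => [|y].
    by exists (s * t) => //=; rewrite mulr_gt0.
  by rewrite /shift -scalerA -scalerDr (sublinearZ _ sp)// mulrBr mulrA.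
move=> q [sq qP _]; have qx y : q y <= p (y + x) - p x.
  by rewrite -shift1; apply: qP; exists 1 => //=.
exists q; split=> // y; have := qx y; have := pD y x; lra.
Qed.

(** A minimal sublinear functional q coincides with the functional that
    [sublinear_directional] produces from q and y, whence
    q x + q y <= q (x + y) and q is linear. *)
Lemma hahn_banach_sublinear (R : realType) (E : lmodType R) (p : E -> R) :
  sublinear p -> exists phi : E -> R, scalar phi /\ forall x, phi x <= p x.
Proof.
move=> sp; pose T := {q | sublinear q /\ forall x, q x <= p x}.
pose below (q r : T) := `[< forall x, sval r x <= sval q x >].
have [||q r /asboolP qr /asboolP rq|A totA|[q [sq qp]] qmin] := @Zorn T below.
- by move=> q; apply/asboolP.
- move=> q r s /asboolP qr /asboolP rs; apply/asboolP => x.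
  exact: le_trans (rs x) (qr x).
- apply: eq_sig_hprop => [? ? ?|]; first exact: Prop_irrelevance.
  by apply/funext => x; apply/le_anti; rewrite qr rq.
- have [->|/set0P[a0 Aa0]] := eqVneq A set0.
    by exists (exist _ p (conj sp (fun=> lexx _))).
  have [|x|_ _ [q Aq <-] [r Ar <-]|_ t [q Aq <-] t0|] :=
    @sublinear_inf _ _ [set sval a | a in A].
  + by exists (sval a0), a0.
  + exists (- p (- x)) => _ [[q [sq qp]] _ <-] /=.
    by rewrite (le_trans _ (sublinear_geN x sq))// lerN2.
  + case: (totA _ _ Aq Ar) => /asboolP le; [exists (sval r)|exists (sval q)].
    * by exists r.
    * by move=> x y; rewrite (le_trans ((svalP r).1.1 _ _))// lerD2r le.
    * by exists q.
    * by move=> x y; rewrite (le_trans ((svalP q).1.1 _ _))// lerD2l le.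
  + by exists (sval q) => [|x]; [exists q|exact: (svalP q).1.2].
  + move=> i [si iA _].
    have ip x : i x <= p x.
      by rewrite (le_trans _ ((svalP a0).2 x))// iA//; exists a0.
    exists (exist _ i (conj si ip)) => s As; apply/asboolP => x /=.
    by apply: iA; exists s.
have qD x y : q (x + y) = q x + q y.
  apply/le_anti; rewrite sq.1 /=.
  have [r [sr rq rx]] := sublinear_directional y sq.
  have rp z : r z <= p z := le_trans (rq z) (qp z).
  have /(congr1 sval) /= := qmin (exist _ r (conj sr rp)) (asboolT rq).
  by move=> rE; have := rx x; rewrite rE; lra.
have qN x : q (- x) = - q x.
  by have := qD x (- x); rewrite subrr (sublinear0 sq); lra.
exists q; split=> // a x y; rewrite qD; congr (_ + _).
have [a0|a0|->] := ltgtP a 0.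
- by rewrite -[a]opprK scaleNr qN (sublinearZ _ sq) ?oppr_gt0// !mulNr.
- exact: sublinearZ.
- by rewrite scale0r mul0r (sublinear0 sq).
Qed.

Definition dual_ball (R : realType) (E : normedModType R) : set (E -> R) :=
  [set phi | scalar phi /\ forall x, `|phi x| <= `|x|].

Lemma dual_ballB (R : realType) (E : normedModType R) (phi : E -> R) x y :
  dual_ball phi -> `|phi x - phi y| <= `|x - y|.
Proof.
move=> [lphi phi1].
by have <- : phi (x - y) = phi x - phi y by rewrite addrC -scaleN1r lphi; lra.
Qed.

(** A linear functional below the directional modification of the norm along x
    has value at most - |x| at - x, hence at least |x| at x. *)
Lemma norming_functional (R : realType) (E : normedModType R) (x : E) :
  exists2 phi, dual_ball phi & phi x = `|x|.
Proof.
have sn : sublinear (fun y : E => `|y|).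
  by split=> [y z|t y t0]; [exact: ler_normD|rewrite normrZ gtr0_norm].
have [p [sp pn px]] := sublinear_directional x sn.
have [phi [lphi phip]] := hahn_banach_sublinear sp.
have phin y : phi y <= `|y| by exact: le_trans (phip y) (pn y).
have phi0 : phi 0 = 0 by have := lphi 1 0 0; rewrite scaler0 addr0; lra.
have phiN y : phi (- y) = - phi y.
  by have := lphi (-1) y 0; rewrite scaleN1r addr0 phi0; lra.
exists phi; first split=> // y.
  by rewrite ler_norml phin lerNl -phiN -normrN phin.
apply/le_anti; rewrite phin /= -lerN2 -phiN (le_trans (phip _))//.
by rewrite (le_trans (px _))// addNr normr0 sub0r.
Qed.

(** * A binary tree in the dual ball *)

(** Going from psi v to psi (rcons v b), the earlier answers are kept and the
    answer to test number size v is changed to b if that is possible within K;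
    otherwise psi v itself is kept. So the first N answers are fixed once N
    letters have been read, and a word spelling the answers of a given phi
    never meets an obstruction, since phi itself is a witness. *)
Lemma binary_tree_of_tests (T : Type) (K : set T) (c : nat -> T -> bool) :
  K !=set0 ->
  exists psi : word -> T,
    [/\ forall v, K (psi v),
        forall v N k, (k < N)%N -> c k (psi v) = c k (psi (take N v)) &
        forall phi N, K phi ->
          exists v, forall k, (k < N)%N -> c k (psi v) = c k phi].
Proof.
move=> [phi0 Kphi0].
pose agree n phi phi' := forall k, (k < n)%N -> c k phi = c k phi'.
have step_ex (s : nat * T * bool) : exists phi', K s.1.2 ->
    [/\ K phi', agree s.1.1 phi' s.1.2 &
        forall phi, K phi -> agree s.1.1 phi s.1.2 -> c s.1.1 phi = s.2 ->
          c s.1.1 phi' = s.2].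
  case: s => [[n phi] b] /=.
  have [[phi' [? ? ?]]|no] :=
      pselect (exists phi', [/\ K phi', agree n phi' phi & c n phi' = b]).
    by exists phi'.
  exists phi => Kphi; split=> // phi' Kphi' ag cb.
  by case: no; exists phi'.
have [step stepP] := choice step_ex.
(* The tree grows at the end of words, so the recursion runs on reversals. *)
pose branch := fix F (s : seq bool) : T :=
  if s is b :: s' then step (size s', F s', b) else phi0.
pose psi v := branch (rev v).
have psi_rcons v b : psi (rcons v b) = step (size v, psi v, b).
  by rewrite /psi rev_rcons /= size_rev.
have Kpsi v : K (psi v).
  elim/last_ind: v => // v b IH; rewrite psi_rcons.
  by have [] := stepP (size v, psi v, b) IH.
exists psi; split=> // [v N|phi N Kphi].
  elim/last_ind: v => // v b IH k kN.
  have [vN|Nv] := ltnP (size v) N; first by rewrite take_oversize// size_rcons.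
  rewrite -cats1 takel_cat// -IH// cats1 psi_rcons.
  have [_ ag _] := stepP (size v, psi v, b) (Kpsi v).
  exact/ag/(leq_trans kN).
suff [v [sv vP]] : exists v, size v = N /\ agree N (psi v) phi by exists v.
elim: N => [|N [v [sv vP]]]; first by exists [::].
exists (rcons v (c N phi)); split; first by rewrite size_rcons sv.
have [_ ag hit] := stepP (size v, psi v, c N phi) (Kpsi v).
move=> k; rewrite psi_rcons ltnS leq_eqVlt => /predU1P[->|kN].
  by have := hit phi; rewrite /= sv; apply=> // j jN; rewrite vP.
by rewrite ag /= ?sv// vP.
Qed.

(** Indices that code no point of the dense set get an arbitrary value. *)
Lemma separable_dense_sequence (R : realType) (E : normedModType R) :
  separable_space E ->
  exists d : nat -> E, forall x e, 0 < e -> exists i, `|x - d i| < e.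
Proof.
move=> [D [/countable_injP[f finj] dD]].
have near x e : 0 < e -> exists2 y, D y & `|x - y| < e.
  move=> e0; have [||y [xy Dy]] := dD (ball x e).
  - by exists x; exact: ballxx.
  - exact: ball_open.
  by exists y => //; rewrite -ball_normE in xy.
have /choice[d dP] i : exists y, forall z, D z -> f z = i -> z = y.
  have [[y [Dy fy]]|no] := pselect (exists y, D y /\ f y = i); last first.
    by exists 0 => z Dz fz; case: no; exists z.
  by exists y => z Dz fz; apply: finj; rewrite ?inE ?fy.
by exists d => x e /(near x)[y Dy xy]; exists (f y); rewrite -(dP _ _ Dy).
Qed.

(** Test (i, m, j), coded as a natural number, asks whether phi (d i) lies in
    the j-th cell of the subdivision of [-|d i|, +oo) into cells of
    length 1/(m+1). On the unit ball phi (d i) lies in [-|d i|, |d i|], so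
    finitely many cells matter, and agreement on them bounds the difference at
    d i by 1/(m+1). The functionals of the ball being 1-Lipschitz, approximating
    x by some d i transfers the bound to x. *)
Lemma dual_ball_tests (R : realType) (E : normedModType R) :
  separable_space E ->
  exists c : nat -> (E -> R) -> bool, forall x e, 0 < e ->
    exists N, forall phi phi', dual_ball phi -> dual_ball phi' ->
      (forall k, (k < N)%N -> c k phi = c k phi') -> `|phi x - phi' x| <= e.
Proof.
move=> /separable_dense_sequence[d dense_d].
pose cell m i (phi : E -> R) := Num.truncn (m.+1%:R * (phi (d i) + `|d i|)).
pose c k phi := if @unpickle (nat * nat * nat)%type k is Some (i, m, j)
                then cell m i phi == j else false.
exists c => x e e0; have e40 : 0 < e / 4 by rewrite divr_gt0.
have [i xi] := dense_d x _ e40.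
pose m := Num.truncn (e / 4)^-1.
have me : m.+1%:R^-1 < e / 4.
  by rewrite invf_plt ?posrE// truncnS_gt.
pose B := Num.truncn (m.+1%:R * (`|d i| + `|d i|)).
have dge0 phi : dual_ball phi -> 0 <= m.+1%:R * (phi (d i) + `|d i|).
  move=> [_ /(_ (d i))]; rewrite ler_norml => phi1.
  by apply: mulr_ge0 => //; lra.
exists (\max_(j < B.+1) (@pickle (nat * nat * nat)%type (i, m, j : nat)).+1)%N.
move=> phi phi' bphi bphi' cE.
have jB : (cell m i phi < B.+1)%N.
  rewrite ltnS le_truncn// ler_wpM2l// lerD2r (le_trans (ler_norm _))//.
  exact: bphi.2.
have cellE : cell m i phi' = cell m i phi.
  have /cE : (pickle (i, m, cell m i phi) <
      \max_(j < B.+1) (@pickle (nat * nat * nat)%type (i, m, j : nat)).+1)%N.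
    exact: (leq_bigmax (Ordinal jB)).
  by rewrite /c pickleK eqxx => /esym/eqP.
have di : `|phi (d i) - phi' (d i)| <= e / 4.
  have := truncn_itv (dge0 _ bphi); have := truncn_itv (dge0 _ bphi').
  rewrite -!/(cell m i phi) -/(cell m i phi') cellE.
  rewrite !mulrDr -natr1 => a' a.
  apply: le_trans (ltW me); rewrite -div1r ler_pdivlMr//.
  by rewrite -[X in _ * X]ger0_norm// -normrM mulrC mulrBr ler_norml; lra.
have := dual_ballB x (d i) bphi; have := dual_ballB x (d i) bphi'.
move: xi di; rewrite !ler_norml; lra.
Qed.

(** * The universal language *)

(** Each letter is preceded by true and the end is marked by false, so the code
    of u can be recognized at the front of a longer word. *)
Fixpoint self_delimiting (u : word) : word :=
  if u is b :: u' then true :: b :: self_delimiting u' else [:: false].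

Lemma self_delimiting_inj u u' v v' :
  self_delimiting u ++ v = self_delimiting u' ++ v' -> u = u' /\ v = v'.
Proof.
by elim: u u' => [|b u IH] [|b' u'] //= [] => [->//|-> /IH[-> ->]].
Qed.

Definition prefix_language : set word :=
  [set w | exists u v, prefix u v /\ w = self_delimiting u ++ v].

Lemma left_quotient_prefix_language u :
  left_quotient (self_delimiting u) prefix_language = [set v | prefix u v].
Proof.
apply/seteqP; split=> v /= => [[u' [v' [+ /self_delimiting_inj[-> ->]]]]//|uv].
by exists u, v.
Qed.

(** * Functions in the closed span of the cones *)

Lemma lin_spanZ (R : pzRingType) (V : lmodType R) (G : set V) a x :
  G x -> lin_span G (a *: x).
Proof.
by move=> Gx; exists 1, (fun=> a), (fun=> x); rewrite big_ord1.
Qed.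

Lemma lin_spanD (R : pzRingType) (V : lmodType R) (G : set V) x y :
  lin_span G x -> lin_span G y -> lin_span G (x + y).
Proof.
move=> [m [c [a [Ga ->]]]] [n [d [b [Gb ->]]]].
exists (m + n)%N.
exists (fun i => match fintype.split i with inl j => c j | inr k => d k end).
exists (fun i => match fintype.split i with inl j => a j | inr k => b k end).
split=> [i|]; first by case: fintype.split.
rewrite big_split_ord; congr (_ + _); apply: eq_bigr => i _.
  by rewrite (unsplitK (inl i)).
by rewrite (unsplitK (inr i)).
Qed.

Lemma lin_span_sum (R : pzRingType) (V : lmodType R) (G : set V)
    (I : finType) (F : I -> V) :
  (forall i, lin_span G (F i)) -> lin_span G (\sum_i F i).
Proof.
move=> GF; apply: big_ind => //; last exact: lin_spanD.
by exists 0%N, (fun=> 0), (fun=> 0); split=> [[]//|]; rewrite big_ord0.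
Qed.

Lemma scale_prefix_indicE (R : realType) (a : R) (u v : word) :
  (a *: ell_indic [set w : word | prefix u w]) v =
  a * (prefix u v)%:R.
Proof.
transitivity (a * \1_[set w | prefix u w] v) => //; rewrite indicE.
by congr (_ * (nat_of_bool _)%:R); apply/idP/idP; rewrite inE.
Qed.

(** Induction on N: h (take N.+1 v) - h (take N v) is the sum over the words u
    of length N.+1 of h u - h (take N u) times the indicator of the cone at u.
    A word v shorter than N.+1 lies in no such cone, and both truncations are
    then v itself. *)
Lemma truncation_in_span (R : realType) (G : set (ell_infty word R))
    (h : word -> R) N :
  (forall u, G (ell_indic [set v | prefix u v])) ->
  exists2 g, lin_span G g & forall v, g v = h (take N v).
Proof.
move=> GA; elim: N => [|N [g spg gE]].
  exists (h [::] *: ell_indic [set v | prefix [::] v]); first exact: lin_spanZ.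
  by move=> v; rewrite scale_prefix_indicE prefix0s mulr1 take0.
pose incr (u : N.+1.-tuple bool) : ell_infty word R :=
  (h u - h (take N u)) *: ell_indic [set v : word | prefix u v].
have incrE u v : incr u v = (h u - h (take N u)) * (prefix u v)%:R.
  exact: scale_prefix_indicE.
exists (g + \sum_u incr u).
  by apply: lin_spanD => //; apply: lin_span_sum => u; exact: lin_spanZ.
move=> v; transitivity (g v + \sum_u incr u v).
  congr (_ + _); exact: (big_morph (fun f : ell_infty word R => f v)).
rewrite gE; have [Nv|vN] := ltnP N (size v); last first.
  rewrite big1 ?addr0 ?take_oversize//; first exact: leqW.
  move=> u _; rewrite incrE.
  case: (boolP (prefix u v)) => [|_]; last by rewrite mulr0.
  by move=> /size_prefix; rewrite size_tuple leqNgt ltnS vN.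
have su : size (take N.+1 v) == N.+1 by rewrite size_takel.
rewrite (bigD1 (Tuple su))// big1 => [|u uv].
  by rewrite incrE /= addr0 prefix_take mulr1 take_takel// addrC subrK.
rewrite incrE prefixE size_tuple; case: eqP => [uE|]; last by rewrite mulr0.
by rewrite -val_eqE /= uE eqxx in uv.
Qed.

(** * The embedding *)

Theorem corollary9p3 (R : realType) :
  exists L_univ : set word,
    forall E : completeNormedModType R,
      separable_space E -> linear_isometric_embeds E (language_space R L_univ).
Proof.
exists prefix_language => E sepE.
have [c cP] := dual_ball_tests sepE.
have [|psi [psiK psi_take psi_hit]] :=
    @binary_tree_of_tests _ (@dual_ball R E) c.
  by have [phi ? _] := norming_functional (0 : E); exists phi.
have bounded_psi (x : E) : (fun v => psi v x) \in bounded_pred word R.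
  by apply/bounded_predP; exists `|x| => v; exact: (psiK v).2.
pose F (x : E) : ell_infty word R := EllInfty (bounded_psi x).
have linF : linear F.
  by move=> a x y; apply/val_inj/funext => v; exact: (psiK v).1.
pose fF : {linear E -> ell_infty word R} :=
  HB.pack F (GRing.isLinear.Build _ _ _ _ F linF).
exists fF; split=> x.
  apply/le_anti/andP; split.
    by apply: sup_norm_le => // v; exact: (psiK v).2.
  (* A norming functional of x agrees with some psi v on the tests that control
     the value at x up to e. *)
  have [phi Kphi phix] := norming_functional x.
  apply/ler_addgt0Pr => e e0.
  have [N NP] := cP x e e0; have [v vP] := psi_hit phi N Kphi.
  have := NP _ _ (psiK v) Kphi vP; rewrite phix.
  have : `|psi v x| <= `|fF x| by exact: (@sup_norm_ge _ _ (F x)).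
  by rewrite !ler_norml; lra.
(* The truncation at level N, with N the number of tests controlling x up to
   e / 2, lies in the span and is e / 2-close. *)
move=> B /nbhs_ballP[e /= e0 eB].
have [N NP] := cP x (e / 2) (divr_gt0 e0 (ltr0n _ 2)).
have [|g spg gE] := @truncation_in_span R
    [set ell_indic (left_quotient w prefix_language) | w in [set: word]]
    (fun v => psi v x) N.
  move=> u; exists (self_delimiting u) => //.
  by rewrite left_quotient_prefix_language.
exists g; split=> //; apply: eB; rewrite -ball_normE /=.
apply: (@le_lt_trans _ _ (e / 2)); last by lra.
apply: sup_norm_le => [|v]; first by lra.
rewrite [leLHS](_ : _ = `|psi v x - psi (take N v) x|); last by rewrite -gE.
by apply: NP => // k; exact: psi_take.
Qed.
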